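(* Let $\delta>0$, and let $n=pq$ denote a public integer that is the product of two unknown primes $q<p<2q$. (1) Let $\kappa>2$. If $p+q=K+U$ is a $\delta$-approximation of $p+q$ with $K\ge \kappa\sqrt n$, then one can find a $\delta$-approximation of $p$ and a $\delta$-approximation of $q$ in polynomial time. Precisely: there is a polynomial-time algorithm which, on input $n$ and $K$, outputs integers $K_p,K_q$ such that for every $C>0$ there is a constant $c>0$ depending only on $C,\delta,\kappa$ such that, whenever $K\ge\kappa\sqrt n$ and $|p+q-K|<C(p+q)^{1-\delta}$, one has $|p-K_p|<c\,p^{1-\delta}$ and $|q-K_q|<c\,q^{1-\delta}$. (2) Conversely, given a $\delta$-approximation of $p$ and a $\delta$-approximation of $q$, one can find a $\delta$-approximation of $p+q$ in polynomial time. Precisely: there is a polynomial-time algorithm which, on input $n$ and integers $K_p,K_q$, outputs an integer $K$ such that for every $C>0$ there is a constant $c>0$ depending only on $C,\delta$ such that, whenever $|p-K_p|<C p^{1-\delta}$ and $|q-K_q|<C q^{1-\delta}$, one has $|p+q-K|<c\,(p+q)^{1-\delta}$.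
   Context: Definition. Let $m$ be an unknown integer and $\delta>0$. Integers $K,U$ are a $\delta$-approximation of $m$ if $m=K+U$, $K$ is known, and $|U|<c\,m^{1-\delta}$ for some constant $c$. Here ''known'' means available to the algorithm as input (for hypotheses) or computed by it as output (for conclusions); $n$ is public, i.e. always known, while $p,q$ and the remainder $U$ are not. Constants may differ from one occurrence to another but do not depend on $n,p,q$. Polynomial time means polynomial in the bit length of the input. *)

(* Defs.v *)
From Stdlib Require Export Reals ZArith Znumtheory List Arith.
Export ListNotations.

(* Polynomial time is taken with respect to the logarithmic-cost (bit-cost)
   register machine, here with structured control flow: a program uses finitely
   many registers, each holding an unbounded integer, and every operation is
   charged at least the bit length of the numbers it handles.  Up to a
   polynomial this is Turing-machine time: the two stacks of a tape fit in two
   registers, and each operation below costs a Turing machine a number of steps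
   polynomial in the charge. *)

(* Binary digits plus a sign bit; [Z.log2 0 = 0], so zero counts one digit. *)
Definition bitlen (z : Z) : nat := Z.to_nat (Z.log2 (Z.abs z)) + 2.

Inductive binop : Set := Add | Sub | Mul | Div.

(* [Div] is the floor quotient; division by zero returns zero. *)
Definition eval_op (o : binop) (a b : Z) : Z :=
  match o with
  | Add => (a + b)%Z
  | Sub => (a - b)%Z
  | Mul => (a * b)%Z
  | Div => (a / b)%Z
  end.

(* Schoolbook bit costs. *)
Definition cost_op (o : binop) (a b : Z) : nat :=
  match o with
  | Add | Sub => bitlen a + bitlen b
  | Mul | Div => bitlen a * bitlen b
  end.

Inductive prog : Set :=
| Skip
| Const (x : nat) (z : Z)             (* x := z *)
| Op (x : nat) (o : binop) (y z : nat) (* x := y o z *)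
| Seq (P Q : prog)
| IfPos (x : nat) (P Q : prog)        (* if x > 0 then P else Q *)
| WhilePos (x : nat) (P : prog).      (* while x > 0 do P *)

Definition state : Type := nat -> Z.

Definition upd (s : state) (x : nat) (v : Z) : state :=
  fun y => if Nat.eqb y x then v else s y.

(* [exec P s t s']: started in [s], the program [P] halts in [s'] at cost [t]. *)
Inductive exec : prog -> state -> nat -> state -> Prop :=
| exec_Skip s : exec Skip s 1 s
| exec_Const x z s : exec (Const x z) s (bitlen z) (upd s x z)
| exec_Op x o y z s :
    exec (Op x o y z) s (cost_op o (s y) (s z))
      (upd s x (eval_op o (s y) (s z)))
| exec_Seq P Q s t1 s1 t2 s2 :
    exec P s t1 s1 -> exec Q s1 t2 s2 -> exec (Seq P Q) s (t1 + t2) s2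
| exec_IfPos_true x P Q s t s1 :
    (0 < s x)%Z -> exec P s t s1 ->
    exec (IfPos x P Q) s (bitlen (s x) + t) s1
| exec_IfPos_false x P Q s t s1 :
    (s x <= 0)%Z -> exec Q s t s1 ->
    exec (IfPos x P Q) s (bitlen (s x) + t) s1
| exec_WhilePos_true x P s t1 s1 t2 s2 :
    (0 < s x)%Z -> exec P s t1 s1 -> exec (WhilePos x P) s1 t2 s2 ->
    exec (WhilePos x P) s (bitlen (s x) + t1 + t2) s2
| exec_WhilePos_false x P s :
    (s x <= 0)%Z -> exec (WhilePos x P) s (bitlen (s x)) s.

Lemma exec_det P s t s' :
  exec P s t s' -> forall u s'', exec P s u s'' -> t = u /\ s' = s''.
Proof.
  induction 1; intros u s'' H'; inversion H'; subst; auto;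
    try (exfalso; apply (Z.lt_irrefl 0); eapply Z.lt_le_trans; eassumption);
    repeat match goal with
      | IH : forall u s'', exec ?P ?s u s'' -> _, E : exec ?P ?s _ _ |- _ =>
          destruct (IH _ _ E); subst; clear E
      end; auto.
Qed.

(* The inputs are placed in registers 0, 1, ...; all other registers are 0. *)
Definition load (inputs : list Z) : state := fun i => nth i inputs 0%Z.

(* The outputs are read from registers 0, 1, ... on halting. *)
Definition outputs (P : prog) (inputs outs : list Z) : Prop :=
  exists (t : nat) (s : state),
    exec P (load inputs) t s /\
    forall i : nat, (i < length outs)%nat -> s i = nth i outs 0%Z.

Definition input_size (inputs : list Z) : nat := list_sum (map bitlen inputs).

(* [P] halts on every tuple of [k] integers, within a fixed polynomial in the
   total bit length. *)
Definition poly_time (k : nat) (P : prog) : Prop :=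
  exists a d : nat,
    forall inputs : list Z, length inputs = k ->
      exists (t : nat) (s : state),
        exec P (load inputs) t s /\ (t <= a * input_size inputs ^ d + a)%nat.

(* The constant [c] is explicit so that statements can say what it depends on.
   Meaningful for m > 0 only, [Rpower] being junk elsewhere. *)
Definition delta_approximation (delta c : R) (m K U : Z) : Prop :=
  m = (K + U)%Z /\ (IZR (Z.abs U) < c * Rpower (IZR m) (1 - delta))%R.

(* Main.v *)
(** Write [d = p - q] and [D = K^2 - 4n].  Since [d^2 = (p+q)^2 - 4n], one has
    [|sqrt D - d| (sqrt D + d) = |K^2 - (p+q)^2| = |U| |K + p + q|], and
    [K >= kappa sqrt n] with [kappa > 2] keeps [sqrt D] of the order of [p + q];
    hence [sqrt D] is within a constant multiple of [|U|] of [d], and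
    [(K + sqrt D) / 2] of [p].  Rounding costs a bounded amount, which is at most
    a multiple of [|U|] unless [U = 0]; and when [U = 0] the square root is exact
    and nothing is lost, which is what makes [delta > 1] work. *)

Require Import Defs.
From Stdlib Require Import Reals ZArith Znumtheory List.
From Stdlib Require Import Psatz.
Import ListNotations.
Local Open Scope R_scope.

(** * Bit lengths and the cost of one operation *)

Lemma bitlen_le_pow2 (z : Z) (j : nat) :
  (Z.abs z <= 2 ^ Z.of_nat j)%Z -> (bitlen z <= j + 2)%nat.
Proof.
  intros H. unfold bitlen.
  apply Z.log2_le_mono in H. rewrite Z.log2_pow2 in H by lia. lia.
Qed.

Lemma abs_lt_pow2_bitlen (z : Z) : (Z.abs z < 2 ^ Z.of_nat (bitlen z))%Z.
Proof.
  unfold bitlen.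
  destruct (Z.eq_dec z 0) as [->|Hz]; [reflexivity|].
  eapply Z.lt_le_trans; [apply Z.log2_spec; lia|].
  apply Z.pow_le_mono_r; [lia|].
  pose proof (Z.log2_nonneg (Z.abs z)). lia.
Qed.

Lemma cost_op_le (o : binop) (x y : Z) (b : nat) :
  (2 <= b)%nat -> (bitlen x <= b)%nat -> (bitlen y <= b)%nat ->
  (cost_op o x y <= b * b)%nat.
Proof. intros; destruct o; cbn [cost_op]; nia. Qed.

(** * The program: integer square root by bisection, its correctness and its cost *)

(* Register 2 holds [D + 1], registers 5 and 3 the bounds [lo] and [hi] with
   [lo^2 <= D < hi^2], register 6 the loop test [hi - lo - 1]; registers 4, 8
   and 10 hold the constants 1, 2 and 0. *)
Definition bisect_step : prog :=
  Seq (Op 7 Defs.Add 3 5)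
  (Seq (Op 7 Div 7 8)
  (Seq (Op 9 Mul 7 7)
  (Seq (Op 9 Sub 2 9)
  (Seq (IfPos 9 (Op 5 Defs.Add 7 10) (Op 3 Defs.Add 7 10))
  (Seq (Op 6 Sub 3 5)
       (Op 6 Sub 6 4)))))).

(** Storing [D + 1] turns the bisection test [mid^2 <= D] into the strict positivity that [IfPos]
    decides. Register 5 starts at 0, so it serves both as the zero that copies [D + 1] into [hi] and
    as the initial [lo]. The second output is the complement of the first in [K], which ties its
    error to that of the first. *)
Definition split_sum : prog :=
  Seq (Op 2 Mul 1 1)
  (Seq (Const 3 4)
  (Seq (Op 3 Mul 3 0)
  (Seq (Op 2 Sub 2 3)
  (Seq (Const 4 1)
  (Seq (Op 2 Defs.Add 2 4)
  (Seq (Op 3 Defs.Add 2 5)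
  (Seq (Op 6 Sub 3 4)
  (Seq (Const 8 2)
  (Seq (WhilePos 6 bisect_step)
  (Seq (Op 0 Defs.Add 1 5)
  (Seq (Op 0 Div 0 8)
       (Op 1 Sub 1 0)))))))))))).

(** [E] stands for [D + 1]. Registers 7 and 9 are scratch, written in each round before they are
    read. *)
Definition bisect_inv (K E lo hi : Z) (s : state) : Prop :=
  s 1%nat = K /\ s 2%nat = E /\ s 3%nat = hi /\ s 4%nat = 1%Z /\ s 5%nat = lo /\
  s 6%nat = (hi - lo - 1)%Z /\ s 8%nat = 2%Z /\ s 10%nat = 0%Z.

(** All numbers handled are at most [4 * E^2] in absolute value, hence have at most [j + 2] digits;
    seven operations and one test give the factor 8. The measure is [hi - lo - 1] because rounding
    [mid] leaves a gap of at most half of [hi - lo + 1]. *)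
Lemma bisect_step_exec (K E lo hi : Z) (s : state) (j : nat) :
  bisect_inv K E lo hi s ->
  (0 <= lo)%Z -> (lo + 1 < hi)%Z -> (hi <= E)%Z -> (lo * lo < E <= hi * hi)%Z ->
  (4 * (E * E) <= 2 ^ Z.of_nat j)%Z ->
  exists (t : nat) (s' : state) (lo' hi' : Z),
    exec bisect_step s t s' /\ bisect_inv K E lo' hi' s' /\
    (t <= 8 * ((j + 2) * (j + 2)))%nat /\
    (0 <= lo')%Z /\ (lo' < hi')%Z /\ (hi' <= E)%Z /\
    (lo' * lo' < E <= hi' * hi')%Z /\ (2 * (hi' - lo' - 1) <= hi - lo - 1)%Z.
Proof.
  intros (H1 & H2 & H3 & H4 & H5 & H6 & H8 & H10) Hlo Hgap Hhi HE Hj.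
  set (mid := ((hi + lo) / 2)%Z).
  assert (Hmid : (hi + lo - 1 <= 2 * mid <= hi + lo)%Z).
  { unfold mid. pose proof (Z.div_mod (hi + lo) 2).
    pose proof (Z.mod_pos_bound (hi + lo) 2). lia. }
  assert (Hb : forall z, (Z.abs z <= 4 * (E * E))%Z -> (bitlen z <= j + 2)%nat).
  { intros z Hz. apply bitlen_le_pow2. lia. }
  assert (Hmm : (0 <= mid * mid <= E * E)%Z) by nia.
  (* The open gap forces [E >= 2]; hence [hi + lo] and the constant 2 also stay within the common
     bound. *)
  assert (HEE : (2 * E <= E * E)%Z) by nia.
  assert (Hc : forall o x y, (Z.abs x <= 4 * (E * E))%Z ->
                 (Z.abs y <= 4 * (E * E))%Z ->
                 (cost_op o x y <= (j + 2) * (j + 2))%nat).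
  { intros. apply cost_op_le; auto; lia. }
  assert (HbE : (bitlen (E - mid * mid) <= (j + 2) * (j + 2))%nat).
  { eapply Nat.le_trans; [apply Hb; lia | nia]. }
  destruct (Z_lt_le_dec 0 (E - mid * mid)) as [Hpos | Hneg].
  - do 2 eexists. exists mid, hi. split; [|split].
    + unfold bisect_step.
      eapply exec_Seq; [constructor|]. eapply exec_Seq; [constructor|].
      eapply exec_Seq; [constructor|]. eapply exec_Seq; [constructor|].
      eapply exec_Seq.
      { apply exec_IfPos_true; [|constructor].
        cbn. rewrite H3, H5, H8, H2. exact Hpos. }
      eapply exec_Seq; constructor.
    + unfold bisect_inv, upd; cbn - [Z.div Z.mul Z.sub Z.add].
      rewrite H3, H5, H8, H4, H10. fold mid.
      repeat split; auto; lia.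
    + split; [|repeat split; lia].
      unfold upd; cbn - [Z.div Z.mul Z.sub Z.add cost_op bitlen Nat.mul].
      rewrite H3, H5, H8, H4, H2, H10. fold mid. rewrite !Z.add_0_r.
      pose proof (Hc Defs.Add hi lo ltac:(lia) ltac:(lia)).
      pose proof (Hc Div (hi + lo)%Z 2%Z ltac:(lia) ltac:(lia)).
      pose proof (Hc Mul mid mid ltac:(lia) ltac:(lia)).
      pose proof (Hc Sub E (mid * mid)%Z ltac:(lia) ltac:(lia)).
      pose proof (Hc Defs.Add mid 0%Z ltac:(lia) ltac:(lia)).
      pose proof (Hc Sub hi mid ltac:(lia) ltac:(lia)).
      pose proof (Hc Sub (hi - mid)%Z 1%Z ltac:(lia) ltac:(lia)).
      lia.
  - do 2 eexists. exists lo, mid. split; [|split].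
    + unfold bisect_step.
      eapply exec_Seq; [constructor|]. eapply exec_Seq; [constructor|].
      eapply exec_Seq; [constructor|]. eapply exec_Seq; [constructor|].
      eapply exec_Seq.
      { apply exec_IfPos_false; [|constructor].
        cbn. rewrite H3, H5, H8, H2. exact Hneg. }
      eapply exec_Seq; constructor.
    + unfold bisect_inv, upd; cbn - [Z.div Z.mul Z.sub Z.add].
      rewrite H3, H5, H8, H4, H10. fold mid.
      repeat split; auto; lia.
    + split; [|repeat split; lia].
      unfold upd; cbn - [Z.div Z.mul Z.sub Z.add cost_op bitlen Nat.mul].
      rewrite H3, H5, H8, H4, H2, H10. fold mid. rewrite !Z.add_0_r.
      pose proof (Hc Defs.Add hi lo ltac:(lia) ltac:(lia)).
      pose proof (Hc Div (hi + lo)%Z 2%Z ltac:(lia) ltac:(lia)).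
      pose proof (Hc Mul mid mid ltac:(lia) ltac:(lia)).
      pose proof (Hc Sub E (mid * mid)%Z ltac:(lia) ltac:(lia)).
      pose proof (Hc Defs.Add mid 0%Z ltac:(lia) ltac:(lia)).
      pose proof (Hc Sub mid lo ltac:(lia) ltac:(lia)).
      pose proof (Hc Sub (mid - lo)%Z 1%Z ltac:(lia) ltac:(lia)).
      lia.
Qed.

(** [k] bounds the number of rounds, as each one halves [hi - lo - 1]. A round costs 8 units of
    [(j + 2)^2] and its loop test one more; the extra 1 in [k + 1] pays for the final failing test.
    On exit [hi = lo + 1], and the bracket identifies [lo] as the integer square root. *)
Lemma bisect_loop_exec (j k : nat) :
  forall (K E lo hi : Z) (s : state),
  bisect_inv K E lo hi s ->
  (0 <= lo)%Z -> (lo < hi)%Z -> (hi <= E)%Z -> (lo * lo < E <= hi * hi)%Z ->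
  (4 * (E * E) <= 2 ^ Z.of_nat j)%Z ->
  (hi - lo - 1 < 2 ^ Z.of_nat k)%Z ->
  exists (t : nat) (s' : state),
    exec (WhilePos 6 bisect_step) s t s' /\
    (t <= (k + 1) * (9 * ((j + 2) * (j + 2))))%nat /\
    bisect_inv K E (Z.sqrt (E - 1)) (Z.sqrt (E - 1) + 1) s'.
Proof.
  induction k as [|k IH]; intros K E lo hi s Hinv Hlo Hlt Hhi HE Hj Hk;
    (* The test cost and the exit case are common to base and step. What remains of the base case is
       an open gap, which [k = 0] excludes. *)
    (assert (Htest : (bitlen (s 6%nat) <= (j + 2) * (j + 2))%nat);
     [ destruct Hinv as (_ & _ & _ & _ & _ & -> & _);
       eapply Nat.le_trans; [apply (bitlen_le_pow2 _ j); nia | nia] | ]);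
    (destruct (Z_lt_le_dec (lo + 1) hi) as [Hgap | Hdone];
     [ | assert (hi = lo + 1)%Z as -> by lia;
         assert (Z.sqrt (E - 1) = lo) as -> by (apply Z.sqrt_unique; lia);
         do 2 eexists; split; [|split; [|exact Hinv]];
         [apply exec_WhilePos_false;
          destruct Hinv as (_ & _ & _ & _ & _ & -> & _); lia | nia]]).
  - cbn in Hk. lia.
  - destruct (bisect_step_exec K E lo hi s j)
      as (t1 & s1 & lo' & hi' & Hex & Hinv' & Ht1 & Hlo' & Hlt' & Hhi' & HE' & Hhalf);
      auto.
    destruct (IH K E lo' hi' s1) as (t2 & s2 & Hex2 & Ht2 & Hinv2); auto.
    { rewrite Nat2Z.inj_succ, Z.pow_succ_r in Hk; lia. }
    do 2 eexists; split; [|split; [|exact Hinv2]].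
    + eapply exec_WhilePos_true; eauto.
      destruct Hinv as (_ & _ & _ & _ & _ & -> & _); lia.
    + nia.
Qed.

(** Stated for all integers, negative [D] included, because [poly_time] demands halting on every
    input. *)
Lemma split_sum_exec (n K : Z) :
  exists (t : nat) (s : state),
    exec split_sum (load [n; K]) t s /\
    (t <= 30 * (4 * input_size [n; K] + 10) ^ 3)%nat /\
    s 0%nat = ((K + Z.sqrt (K * K - 4 * n)) / 2)%Z /\
    s 1%nat = (K - (K + Z.sqrt (K * K - 4 * n)) / 2)%Z.
Proof.
  set (I := input_size [n; K]).
  set (D := (K * K - 4 * n)%Z).
  assert (HI : (bitlen n <= I /\ bitlen K <= I)%nat)
    by (unfold I, input_size; cbn; lia).
  clearbody I.
  set (X := (2 ^ Z.of_nat I)%Z).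
  assert (HX : (1 <= X)%Z) by (unfold X; nia).
  assert (Hpow : forall z, (bitlen z <= I)%nat -> (Z.abs z <= X)%Z).
  { intros z Hz. apply Z.lt_le_incl. eapply Z.lt_le_trans; [apply abs_lt_pow2_bitlen|].
    apply Z.pow_le_mono_r; lia. }
  pose proof (Hpow n (proj1 HI)) as Hn. pose proof (Hpow K (proj2 HI)) as HK.
  assert (HXX : (2 ^ Z.of_nat (4 * I + 8) = 256 * (X * X * (X * X)))%Z).
  { unfold X. rewrite <- !Z.pow_add_r by lia. change 256%Z with (2 ^ 8)%Z.
    rewrite <- Z.pow_add_r by lia. f_equal. lia. }
  assert (HX2 : (X <= X * X)%Z) by nia.
  assert (HX4 : (X * X <= X * X * (X * X))%Z) by nia.
  assert (HKK : (0 <= K * K <= X * X)%Z) by nia.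
  assert (HE : (Z.abs (D + 1) <= 6 * (X * X))%Z) by (unfold D; lia).
  (* From [|D + 1| <= 6 * X^2] one gets [4 * (D + 1)^2 <= 144 * X^4], which is below
     [256 * X^4 = 2^j]. *)
  set (j := (4 * I + 8)%nat).
  assert (HEj : (4 * ((D + 1) * (D + 1)) <= 2 ^ Z.of_nat j)%Z).
  { unfold j. rewrite HXX. nia. }
  set (s0 := load [n; K]).
  (* The state after the nine assignments before the loop, with the stored values simplified. *)
  set (s1 := upd (upd (upd (upd (upd (upd (upd (upd (upd s0
    2%nat (K * K)%Z) 3%nat 4%Z) 3%nat (4 * n)%Z) 2%nat D) 4%nat 1%Z)
    2%nat (D + 1)%Z) 3%nat (D + 1)%Z) 6%nat D) 8%nat 2%Z).
  assert (Hloop : exists (t : nat) (s' : state),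
    exec (WhilePos 6 bisect_step) s1 t s' /\
    (t <= (j + 2) * (9 * ((j + 2) * (j + 2))))%nat /\
    s' 1%nat = K /\ s' 5%nat = Z.sqrt D /\ s' 8%nat = 2%Z /\
    (Z.abs (Z.sqrt D) <= 6 * (X * X))%Z).
  { destruct (Z_lt_le_dec D 0) as [HD | HD].
    (* For [D < 0] the loop is skipped and register 5 keeps 0, which is also the value of [Z.sqrt]
       on negative numbers. *)
    - do 2 eexists. split; [apply exec_WhilePos_false; cbn; lia|].
      rewrite Z.sqrt_neg by lia. repeat split; try lia.
      eapply Nat.le_trans; [apply (bitlen_le_pow2 _ j); change (s1 6%nat) with D; unfold j; rewrite HXX; lia|].
      nia.
    (* The initial gap gives [hi - lo - 1 = D < 2^(j + 1)]; with this [k] the loop bound is cubic in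
       [j + 2]. *)
    - destruct (bisect_loop_exec j (j + 1) K (D + 1) 0 (D + 1) s1)
        as (t & s' & Hex & Ht & H1 & H2 & H3 & H4 & H5 & H6 & H8 & H10);
        try nia.
      + unfold bisect_inv, s1, upd, s0; cbn - [Z.add Z.sub]. repeat split; lia.
      + rewrite Nat2Z.inj_add, Z.pow_add_r by lia. cbn [Z.of_nat]. nia.
      + exists t, s'. rewrite Z.add_simpl_r in H5.
        pose proof (Z.sqrt_nonneg D). pose proof (Z.sqrt_le_lin D HD).
        repeat split; auto; lia. }
  destruct Hloop as (t & s' & Hex & Ht & H1 & H5 & H8 & Hs).
  assert (Hc : forall o x y, (Z.abs x <= 256 * (X * X * (X * X)))%Z ->
                 (Z.abs y <= 256 * (X * X * (X * X)))%Z ->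
                 (cost_op o x y <= (j + 2) * (j + 2))%nat).
  { intros. apply cost_op_le; [lia| |]; apply bitlen_le_pow2; unfold j; lia. }
  set (S := ((K + Z.sqrt D) / 2)%Z).
  assert (HS : (Z.abs S <= 13 * (X * X))%Z).
  { unfold S. pose proof (Z.div_mod (K + Z.sqrt D) 2).
    pose proof (Z.mod_pos_bound (K + Z.sqrt D) 2). lia. }
  do 2 eexists. split; [|split; [|split]].
  - unfold split_sum.
    do 9 (eapply exec_Seq; [constructor|]).
    eapply exec_Seq.
    { match goal with |- exec _ ?x _ _ => replace x with s1 end; [exact Hex|].
      unfold s1, upd, D; cbn - [Z.mul Z.sub Z.add].
      rewrite Z.add_0_r, Z.add_simpl_r. reflexivity. }
    do 2 (eapply exec_Seq; [constructor|]). constructor.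
  - unfold upd; cbn - [Z.div Z.mul Z.sub Z.add cost_op bitlen Nat.mul Nat.pow s0].
    rewrite H1, H5, H8.
    unfold s0, load; cbn [nth].
    fold D. fold S. rewrite Z.add_0_r.
    pose proof (Hc Mul K K ltac:(lia) ltac:(lia)) as c1.
    pose proof (Hc Mul 4%Z n ltac:(lia) ltac:(lia)) as c2.
    pose proof (Hc Sub (K * K)%Z (4 * n)%Z ltac:(lia) ltac:(lia)) as c3.
    pose proof (Hc Defs.Add D 1%Z ltac:(lia) ltac:(lia)) as c4.
    pose proof (Hc Defs.Add (D + 1)%Z 0%Z ltac:(lia) ltac:(lia)) as c5.
    pose proof (Hc Sub (D + 1)%Z 1%Z ltac:(lia) ltac:(lia)) as c6.
    pose proof (Hc Defs.Add K (Z.sqrt D) ltac:(lia) ltac:(lia)) as c7.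
    pose proof (Hc Div (K + Z.sqrt D)%Z 2%Z ltac:(lia) ltac:(lia)) as c8.
    pose proof (Hc Sub K S ltac:(lia) ltac:(lia)) as c9.
    change (bitlen 4) with 4%nat. change (bitlen 1) with 2%nat.
    change (bitlen 2) with 3%nat.
    replace (4 * I + 10)%nat with (j + 2)%nat by (unfold j; lia).
    assert (Hb : (10 <= j + 2)%nat) by (unfold j; lia).
    clear - Ht Hb c1 c2 c3 c4 c5 c6 c7 c8 c9.
    cbn [Nat.pow]. set (b := (j + 2)%nat) in *.
    assert (10 <= b * b)%nat by nia. assert (b * b <= b * (b * b))%nat by nia.
    lia.
  - unfold upd; cbn - [Z.div Z.mul Z.sub Z.add]. rewrite H1, H5, H8. reflexivity.
  - unfold upd; cbn - [Z.div Z.mul Z.sub Z.add]. rewrite H1, H5, H8. reflexivity.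
Qed.

Lemma split_sum_poly_time : poly_time 2 split_sum.
Proof.
  exists (30 * 7 ^ 3)%nat, 3%nat. intros inputs Hlen.
  destruct inputs as [|n [|K [|]]]; try discriminate.
  destruct (split_sum_exec n K) as (t & s & Hex & Ht & _).
  exists t, s. split; [exact Hex|].
  (* Each [bitlen] is at least 2, so the additive 10 is absorbed into [3 * input_size]; hence the
     [7 ^ 3]. *)
  assert (H4 : (4 <= input_size [n; K])%nat)
    by (unfold input_size, bitlen; cbn; lia).
  assert (Hle : (4 * input_size [n; K] + 10 <= 7 * input_size [n; K])%nat) by lia.
  apply (Nat.pow_le_mono_l _ _ 3) in Hle. rewrite Nat.pow_mul_l in Hle.
  lia.
Qed.

(** * Comparison of powers, and transfer of approximations between comparable integers *)

(** [ln x] and [ln y] differ by at most [ln 3]. The absolute value on the exponent covers [a < 0],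
    that is [delta > 1] when [a = 1 - delta]. *)
Lemma Rpower_comparable (a x y : R) :
  0 < x -> 0 < y -> x <= 3 * y -> y <= 3 * x ->
  Rpower x a <= Rpower 3 (Rabs a) * Rpower y a.
Proof.
  intros Hx Hy Hxy Hyx.
  unfold Rpower. rewrite <- exp_plus.
  assert (H1 : ln x <= ln 3 + ln y).
  { rewrite <- ln_mult by lra. destruct Hxy as [H | ->]; [|lra].
    left; apply ln_increasing; lra. }
  assert (H2 : ln y <= ln 3 + ln x).
  { rewrite <- ln_mult by lra. destruct Hyx as [H | ->]; [|lra].
    left; apply ln_increasing; lra. }
  assert (H : a * ln x <= Rabs a * ln 3 + a * ln y).
  { unfold Rabs; destruct (Rcase_abs a); nra. }
  destruct H as [H | ->]; [|lra]. left; apply exp_increasing; exact H.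
Qed.

(** Carries an error bound from [p + q] to [p] and to [q]: both lie within a factor 3 of the sum,
    since [q < p < 2q]. *)
Lemma delta_approximation_transfer (delta C L : R) (m m' K' U U' : Z) :
  0 < L -> (0 < m)%Z -> (0 < m')%Z -> (m <= 3 * m')%Z -> (m' <= 3 * m)%Z ->
  IZR (Z.abs U) < C * Rpower (IZR m) (1 - delta) -> 0 < C ->
  m' = (K' + U')%Z -> IZR (Z.abs U') <= L * IZR (Z.abs U) ->
  delta_approximation delta (L * C * Rpower 3 (Rabs (1 - delta))) m' K' U'.
Proof.
  intros HL Hm Hm' H1 H2 HU HC Heq HU'. split; [exact Heq|].
  apply IZR_lt in Hm, Hm'. apply IZR_le in H1, H2. rewrite mult_IZR in H1, H2.
  pose proof (Rpower_comparable (1 - delta) _ _ Hm Hm' H1 H2) as Hp.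
  apply (Rmult_le_compat_l (L * C)) in Hp; nra.
Qed.

(** * Error of the computed square root and of the computed factor *)

Lemma IZR_Zsqrt_bounds (D : Z) :
  (0 <= D)%Z -> IZR (Z.sqrt D) <= sqrt (IZR D) < IZR (Z.sqrt D) + 1.
Proof.
  intros HD. destruct (Z.sqrt_spec D HD) as [H1 H2].
  pose proof (Z.sqrt_nonneg D) as H0.
  apply IZR_le in H0, H1. apply IZR_lt in H2. unfold Z.succ in H2.
  rewrite mult_IZR in H1. rewrite mult_IZR, plus_IZR in H2.
  pose proof (sqrt_pos (IZR D)).
  assert (sqrt (IZR D) * sqrt (IZR D) = IZR D)
    by (apply sqrt_sqrt; nra).
  split; nra.
Qed.

(** Bounds the quotient of [K + p + q], at most [(2 + C) * (p + q)], by [sqrt D + p - q], at least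
    [sqrt (kappa^2 - 4) * (p + q) / 3]. *)
Definition sqrt_loss (kappa C : R) : R := 3 * (2 + C) / sqrt (kappa * kappa - 4).

Lemma sqrt_discriminant_close (kappa C p q K : R) :
  2 < kappa -> 0 < C -> 0 < q < p -> p < 2 * q ->
  Rabs (p + q - K) <= C * (p + q) -> kappa * sqrt (p * q) <= K ->
  0 <= K * K - 4 * (p * q) /\
  Rabs (sqrt (K * K - 4 * (p * q)) - (p - q))
    <= sqrt_loss kappa C * Rabs (p + q - K).
Proof.
  intros Hk HC [Hq Hqp] Hp HU HK.
  set (w := sqrt (p * q)) in *.
  assert (Hw : w * w = p * q) by (apply sqrt_sqrt; nra).
  assert (Hw0 : 0 <= w) by apply sqrt_pos.
  assert (Hwq : q <= w) by nra.
  assert (HKK : kappa * w * (kappa * w) <= K * K) by (apply Rmult_le_compat; nra).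
  assert (HD : (kappa * kappa - 4) * (w * w) <= K * K - 4 * (p * q)) by nra.
  assert (Hkk : 0 < kappa * kappa - 4) by nra.
  assert (Hww : 0 <= w * w) by nra.
  split; [nra|].
  unfold sqrt_loss.
  set (e := sqrt (kappa * kappa - 4)).
  assert (He : 0 < e) by (apply sqrt_lt_R0; lra).
  set (r := sqrt (K * K - 4 * (p * q))).
  assert (Hr : r * r = K * K - 4 * (p * q)) by (apply sqrt_sqrt; nra).
  assert (Her : e * w <= r).
  { unfold e, r. rewrite <- (sqrt_square w) at 1 by lra.
    rewrite <- sqrt_mult by lra. apply sqrt_le_1; nra. }
  (* Here [p < 2q] enters: [p + q < 3q <= 3w], while [e * w <= r] and [p - q > 0]. *)
  assert (Hlow : e * (p + q) <= 3 * (r + (p - q))) by nra.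
  set (V := Rabs (p + q - K)) in *.
  assert (HV : 0 <= V) by apply Rabs_pos.
  assert (HsumK : K + (p + q) <= (2 + C) * (p + q)).
  { unfold V in HU. pose proof (Rle_abs (- (p + q - K))) as H.
    rewrite Rabs_Ropp in H. nra. }
  assert (Hprod : Rabs (r - (p - q)) * (r + (p - q)) = V * (K + (p + q))).
  { assert (Hr0 : 0 <= r) by apply sqrt_pos. assert (HK0 : 0 <= K) by nra.
    rewrite <- (Rabs_pos_eq (r + (p - q))) by lra.
    rewrite <- (Rabs_pos_eq (K + (p + q))) by lra.
    unfold V. rewrite <- !Rabs_mult.
    rewrite <- (Rabs_Ropp ((p + q - K) * _)). f_equal. nra. }
  set (x := Rabs (r - (p - q))) in *.
  assert (Hx : 0 <= x) by apply Rabs_pos.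
  assert (H1 : x * (e * (p + q)) <= 3 * V * ((2 + C) * (p + q))).
  { apply Rle_trans with (x * (3 * (r + (p - q)))); [apply Rmult_le_compat_l; lra|].
    replace (x * (3 * (r + (p - q)))) with (3 * V * (K + (p + q))) by nra.
    apply Rmult_le_compat_l; lra. }
  assert (H2 : x * e <= 3 * V * (2 + C)).
  { apply Rmult_le_reg_r with (p + q); lra. }
  apply Rmult_le_reg_r with e; [exact He|].
  replace (3 * (2 + C) / e * V * e) with (3 * V * (2 + C)) by (field; lra).
  exact H2.
Qed.

Lemma split_sum_error (kappa C : R) (p q K : Z) :
  2 < kappa -> 0 < C -> (0 < q < p)%Z -> (p < 2 * q)%Z ->
  IZR (Z.abs (p + q - K)) <= C * IZR (p + q) ->
  kappa * sqrt (IZR (p * q)) <= IZR K ->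
  let Kp := ((K + Z.sqrt (K * K - 4 * (p * q))) / 2)%Z in
  IZR (Z.abs (p - Kp)) <= (3 + sqrt_loss kappa C) * IZR (Z.abs (p + q - K)).
Proof.
  intros Hk HC Hqp Hp HU HK Kp.
  set (D := (K * K - 4 * (p * q))%Z) in *.
  destruct (Z.eq_dec (p + q - K) 0) as [H0 | H0].
  (* The bound to prove is 0. [D] is the square of [p - q] and [K + (p - q) = 2p], so neither the
     root nor the halving rounds. *)
  - assert (HpK : (p - Kp = 0)%Z).
    { unfold Kp. replace D with ((p - q) * (p - q))%Z by (unfold D; nia).
      rewrite Z.sqrt_square by lia.
      replace (K + (p - q))%Z with (p * 2)%Z by lia. rewrite Z.div_mul; lia. }
    rewrite H0, HpK. cbn. lra.
  - destruct Hqp as [Hq Hqp].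
    destruct (sqrt_discriminant_close kappa C (IZR p) (IZR q) (IZR K))
      as [HD Hclose]; auto.
    { split; apply IZR_lt; lia. }
    { rewrite <- mult_IZR. apply IZR_lt; lia. }
    { rewrite <- plus_IZR, <- minus_IZR, <- abs_IZR. exact HU. }
    { rewrite <- mult_IZR. exact HK. }
    rewrite <- mult_IZR, <- mult_IZR, <- mult_IZR, <- minus_IZR in HD, Hclose.
    fold D in HD, Hclose.
    rewrite <- !plus_IZR, <- !minus_IZR, <- (abs_IZR (p + q - K)) in Hclose.
    (* The two roundings shift [2 * Kp] by less than 2 in total, hence by at most [2 * |U|].
       Together with [|U|] from [K] and [sqrt_loss * |U|] from the root this bounds [2 * |p - Kp|],
       and a fortiori [|p - Kp|]. *)
    assert (H1 : 1 <= IZR (Z.abs (p + q - K))) by (apply IZR_le; lia).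
    pose proof (IZR_Zsqrt_bounds D ltac:(apply le_IZR; exact HD)) as Hs.
    assert (Hdiv : (K + Z.sqrt D - 1 <= 2 * Kp <= K + Z.sqrt D)%Z).
    { unfold Kp. pose proof (Z.div_mod (K + Z.sqrt D) 2).
      pose proof (Z.mod_pos_bound (K + Z.sqrt D) 2). lia. }
    destruct Hdiv as [Hd1 Hd2]. apply IZR_le in Hd1, Hd2.
    rewrite minus_IZR, plus_IZR, mult_IZR in Hd1.
    rewrite plus_IZR, mult_IZR in Hd2.
    set (x := sqrt (IZR D) - IZR (p - q)) in *.
    pose proof (Rle_abs x) as Hx1.
    pose proof (Rle_abs (- x)) as Hx2. rewrite Rabs_Ropp in Hx2.
    pose proof (Rle_abs (IZR (p + q - K))) as Ha.
    pose proof (Rle_abs (- IZR (p + q - K))) as Hb. rewrite Rabs_Ropp in Hb.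
    rewrite <- abs_IZR in Ha, Hb.
    rewrite (abs_IZR (p - Kp)).
    set (V := IZR (Z.abs (p + q - K))) in *.
    rewrite minus_IZR, plus_IZR in Ha, Hb. rewrite minus_IZR.
    assert (Hx : x = sqrt (IZR D) - (IZR p - IZR q))
      by (unfold x; rewrite minus_IZR; reflexivity).
    assert (0 <= sqrt_loss kappa C * V)
      by (eapply Rle_trans; [apply Rabs_pos | exact Hclose]).
    apply Rabs_le. lra.
Qed.

Theorem proposition4p4 :
  forall delta : R, 0 < delta ->
    (forall kappa : R, 2 < kappa ->
       exists A : prog, poly_time 2 A /\
         forall C : R, 0 < C ->
         exists c : R, 0 < c /\
           forall n p q : Z,
             n = (p * q)%Z -> prime p -> prime q -> (q < p < 2 * q)%Z ->
             forall K U : Z,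
               delta_approximation delta C (p + q) K U ->
               kappa * sqrt (IZR n) <= IZR K ->
               exists Kp Up Kq Uq : Z,
                 outputs A [n; K] [Kp; Kq] /\
                 delta_approximation delta c p Kp Up /\
                 delta_approximation delta c q Kq Uq)
    /\
    (exists B : prog, poly_time 3 B /\
       forall C : R, 0 < C ->
       exists c : R, 0 < c /\
         forall n p q : Z,
           n = (p * q)%Z -> prime p -> prime q -> (q < p < 2 * q)%Z ->
           forall Kp Up Kq Uq : Z,
             delta_approximation delta C p Kp Up ->
             delta_approximation delta C q Kq Uq ->
             exists K U : Z,
               outputs B [n; Kp; Kq] [K] /\
               delta_approximation delta c (p + q) K U).
Proof.
  intros delta Hdelta. split.
  - intros kappa Hk. exists split_sum. split; [exact split_sum_poly_time|].
    intros C HC.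
    (* [3 + sqrt_loss] is the factor for [p]; one more [|U|] serves [q], because
       [q - (K - Kp) = U - (p - Kp)]. *)
    set (L := 4 + sqrt_loss kappa C).
    assert (HL : 4 < L).
    { unfold L, sqrt_loss.
      assert (0 < 3 * (2 + C) / sqrt (kappa * kappa - 4)); [|lra].
      apply Rdiv_lt_0_compat; [lra|]. apply sqrt_lt_R0. nra. }
    exists (L * C * Rpower 3 (Rabs (1 - delta))). split.
    { apply Rmult_lt_0_compat; [nra | apply exp_pos]. }
    intros n p q -> Hp Hq Hqp K U [HK HU] HkK.
    destruct Hq as [Hq _].
    destruct (split_sum_exec (p * q) K) as (t & s & Hex & _ & H0 & H1).
    set (Kp := ((K + Z.sqrt (K * K - 4 * (p * q))) / 2)%Z) in *.
    assert (HUeq : U = (p + q - K)%Z) by lia.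
    assert (Herr : IZR (Z.abs (p - Kp)) <= (L - 1) * IZR (Z.abs U)).
    { rewrite HUeq. replace (L - 1) with (3 + sqrt_loss kappa C) by (unfold L; lra).
      apply split_sum_error; auto; try lia.
      (* As [p + q >= 1] and [delta > 0], the power [(p + q)^(1 - delta)] is at most [p + q], which
         gives the linear bound on [|U|]. *)
      rewrite <- HUeq. apply Rlt_le. eapply Rlt_le_trans; [exact HU|].
      apply Rmult_le_compat_l; [lra|].
      rewrite <- (Rpower_1 (IZR (p + q))) at 2 by (apply IZR_lt; lia).
      apply Rle_Rpower; [apply IZR_le; lia | lra]. }
    assert (HU0 : 0 <= IZR (Z.abs U)) by (apply IZR_le; lia).
    exists Kp, (p - Kp)%Z, (K - Kp)%Z, (q - (K - Kp))%Z. split; [|split].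
    + exists t, s. split; [exact Hex|].
      intros [|[|i]] Hi; cbn in Hi |- *; [exact H0 | exact H1 | lia].
    + apply (delta_approximation_transfer _ _ _ (p + q) _ _ U); auto; try lia; nra.
    + apply (delta_approximation_transfer _ _ _ (p + q) _ _ U); auto; try lia; try nra.
      assert (Htri : (Z.abs (q - (K - Kp)) <= Z.abs U + Z.abs (p - Kp))%Z) by lia.
      apply IZR_le in Htri. rewrite plus_IZR in Htri. lra.
  - exists (Op 0 Defs.Add 1 2). split.
    { exists 1%nat, 1%nat. intros inputs Hlen.
      destruct inputs as [|n [|Kp [|Kq [|]]]]; try discriminate.
      do 2 eexists. split; [constructor|]. unfold input_size; cbn. lia. }
    intros C HC.
    set (B := Rpower 3 (Rabs (1 - delta))).
    assert (HB : 0 < B) by apply exp_pos.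
    (* One [C * B] for each of [Up] and [Uq], whose powers of [p] and [q] are compared with that of
       [p + q]. *)
    exists (2 * C * B). split; [nra|].
    intros n p q -> Hp Hq Hqp Kp Up Kq Uq [HKp HUp] [HKq HUq].
    destruct Hq as [Hq _].
    exists (Kp + Kq)%Z, (Up + Uq)%Z. split.
    { do 2 eexists. split; [constructor|].
      intros [|i] Hi; cbn in Hi |- *; [reflexivity | lia]. }
    split; [lia|].
    assert (Hbound : forall m, (0 < m)%Z -> (m <= p + q <= 3 * m)%Z ->
              C * Rpower (IZR m) (1 - delta)
                <= C * (B * Rpower (IZR (p + q)) (1 - delta))).
    { intros m Hm [H1 H2]. apply Rmult_le_compat_l; [lra|].
      apply IZR_lt in Hm. apply IZR_le in H1, H2. rewrite mult_IZR in H2.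
      apply Rpower_comparable; lra. }
    pose proof (Hbound p ltac:(lia) ltac:(lia)).
    pose proof (Hbound q ltac:(lia) ltac:(lia)).
    assert (Htri : (Z.abs (Up + Uq) <= Z.abs Up + Z.abs Uq)%Z) by lia.
    apply IZR_le in Htri. rewrite plus_IZR in Htri. lra.
Qed.
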